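(* Let $G$ be a graph. The following conditions are equivalent: (i) every ball $B_r(v)$ ($v\in V(G)$, $r\ge 0$) of $G$ is $2$-convex; (ii) $G$ satisfies $\mathrm{INC}$; (iii) $G$ satisfies $\mathrm{INC}^+$.
   Context: All graphs are simple, undirected, connected (possibly infinite), and all cliques of $G$ are finite (standing assumption). $d$ is the graph distance, $u\sim v$ denotes adjacency, $B_r(v)=\{x: d(v,x)\le r\}$, $S_r(v)=\{x:d(v,x)=r\}$, and $I(u,v)=\{x: d(u,x)+d(x,v)=d(u,v)\}$ is the interval. A set $C$ of vertices is $k$-convex if $I(u,v)\subseteq C$ for all $u,v\in C$ with $d(u,v)\le k$. $\mathrm{INC}^0$: for any two distinct vertices $u,v$, the neighbors of $u$ in $I(u,v)$ form a clique. $\mathrm{INC}$: $\mathrm{INC}^0$ holds and for any two distinct vertices $u,v$ and any $w,w'\in S_1(u)\cap I(u,v)$ there is a vertex $z\in I(w,v)\cap I(w',v)$ with $z\sim w$ and $z\sim w'$. $\mathrm{INC}^+$: $\mathrm{INC}^0$ holds and for any two vertices $u,v$ with $d(u,v)=k\ge 2$ there is a vertex $z\in I(u,v)$ with $d(z,v)=k-2$ adjacent to all vertices of the clique $S_1(u)\cap I(u,v)$.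
   Formalization: In INC the vertices w, w' are taken to be distinct; if w = w' were allowed, adjacent u, v would force z = v with v adjacent to itself, so K_2 would satisfy (i) but not INC. For d(u,v) ≥ 2 the case w = w' holds automatically. *)

(* Defs.v *)
From mathcomp Require Import all_boot.
From mathcomp Require Import boolp classical_sets cardinality.

Set Implicit Arguments.
Unset Strict Implicit.
Unset Printing Implicit Defensive.

Local Open Scope classical_set_scope.

(* A connected simple graph on an arbitrary (possibly infinite) vertex type.
   Adjacency is boolean so that walks are mathcomp [path]s; since the
   development is classical, this does not restrict the class of graphs. *)
Record connGraph := ConnGraph {
  vertex :> Type;
  adj : rel vertex;
  adj_sym : symmetric adj;
  adj_irr : irreflexive adj;
  adj_conn : forall u v : vertex, exists2 p, path adj u p & last u p = v
}.

Section Metric.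
Variable G : connGraph.
Implicit Types (u v w x z : G) (k r n : nat) (C K : set G).

Definition has_walk u v n : bool :=
  `[< exists p : seq G, [/\ path (@adj G) u p, last u p = v & size p = n] >].

Lemma has_walk_ex u v : exists n, has_walk u v n.
Proof.
have [p up pv] := adj_conn u v.
by exists (size p); apply/asboolP; exists p.
Qed.

Definition gdist u v : nat := ex_minn (has_walk_ex u v).

Definition gball r v : set G := [set x | gdist v x <= r].

Definition gsphere r v : set G := [set x | gdist v x = r].

Definition ginterval u v : set G :=
  [set x | gdist u x + gdist x v = gdist u v].

Definition kconvex k C : Prop :=
  forall u v, C u -> C v -> gdist u v <= k -> ginterval u v `<=` C.

Definition clique K : Prop :=
  forall x y : G, K x -> K y -> x <> y -> adj x y.

End Metric.

Definition cliques_finite (G : connGraph) : Prop :=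
  forall K : set G, clique K -> finite_set K.

Definition INC0 (G : connGraph) : Prop :=
  forall u v : G, u <> v -> clique ([set x | adj u x] `&` ginterval u v).

(* [w] and [w'] are two distinct vertices. If [w = w'] were allowed, then for
   adjacent [u] and [v] the choice [w = w' = v] would force [z = v] and
   [adj v v], so that no graph with an edge would satisfy the condition; for
   [gdist u v >= 2] the case [w = w'] holds in every connected graph. *)
Definition INC (G : connGraph) : Prop :=
  INC0 G /\
  forall u v w w' : G, u <> v -> w <> w' ->
    (gsphere 1 u `&` ginterval u v) w ->
    (gsphere 1 u `&` ginterval u v) w' ->
    exists z : G, [/\ (ginterval w v `&` ginterval w' v) z, adj z w & adj z w'].

Definition INCplus (G : connGraph) : Prop :=
  INC0 G /\
  forall (u v : G) (k : nat), gdist u v = k -> 2 <= k ->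
    exists z : G, [/\ ginterval u v z, gdist z v = k - 2 &
      forall w, (gsphere 1 u `&` ginterval u v) w -> adj z w].

(* Main.v *)
Require Import Defs.
From mathcomp Require Import all_boot.
From mathcomp Require Import boolp classical_sets cardinality.
From mathcomp Require Import zify.

(** The local condition INC0 already forces the other two properties: every
    ball is 2-convex, and INC follows by induction on d(u,v).  Given
    distinct neighbors w, w' of u in I(u,v), take geodesics w, x, ..., p, v and
    w', y, ..., q, v.  If w' is on a geodesic from u to p, or w on one from u
    to q, replace v by p or q.  Otherwise p and q are adjacent by INC0, hence
    w' and x both lie in I(w,q), and INC0 makes them adjacent.
    For INC+, one member of the clique is absorbed at a time: INC provides the
    new vertex, which keeps the old adjacencies as INC0 forbids induced
    4-cycles. *)

Set Implicit Arguments.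
Unset Strict Implicit.
Unset Printing Implicit Defensive.

Local Open Scope classical_set_scope.

Section GraphDistance.
Variable G : connGraph.
Implicit Types u v w x y z : G.

Lemma gdist_walk u v :
  exists p : seq G, [/\ path (@adj G) u p, last u p = v & size p = gdist u v].
Proof. by rewrite /gdist; case: ex_minnP => n /asboolP. Qed.

Lemma gdist_le_size u (p : seq G) :
  path (@adj G) u p -> gdist u (last u p) <= size p.
Proof.
move=> up; rewrite /gdist; case: ex_minnP => n _; apply.
by apply/asboolP; exists p.
Qed.

Lemma gdist_triangle u v w : gdist u w <= gdist u v + gdist v w.
Proof.
have [p [up pv <-]] := gdist_walk u v.
have [q [vq qw <-]] := gdist_walk v w.
rewrite -size_cat -qw -pv -last_cat; apply: gdist_le_size.
by rewrite cat_path up pv.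
Qed.

Lemma gdist_xx u : gdist u u = 0.
Proof. by apply/eqP; rewrite -leqn0 (gdist_le_size (p := [::])). Qed.

Lemma gdist_eq0 u v : gdist u v = 0 -> u = v.
Proof. by have [p [_ <- <-]] := gdist_walk u v => /size0nil ->. Qed.

Lemma adj_gdist u v : adj u v -> gdist u v = 1.
Proof.
move=> uv; have : gdist u v <= 1.
  by apply: (gdist_le_size (p := [:: v])); rewrite /= uv.
case E: (gdist u v) => [|[|//]] // _.
by move: uv; rewrite (gdist_eq0 E) adj_irr.
Qed.

Lemma gdist1_adj u v : gdist u v = 1 -> adj u v.
Proof.
move=> uv; have [p] := gdist_walk u v; rewrite uv.
by case: p => [|a [|b p]] [up pv] // _; move: up; rewrite /= -pv andbT.
Qed.

Lemma gdist_sym u v : gdist u v = gdist v u.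
Proof.
suff le x y : gdist x y <= gdist y x by apply/eqP; rewrite eqn_leq !le.
have [p [yp <- <-]] := gdist_walk y x.
(* [rev (belast y p)] is the reversed walk, leading from [last y p] back to [y]. *)
have lasty : last (last y p) (rev (belast y p)) = y.
  by case: (p) => // a q; rewrite /= rev_cons last_rcons.
rewrite -(size_belast y p) -size_rev -{2}lasty; apply: gdist_le_size.
by rewrite rev_path (eq_path (e' := @adj G)) // => a b; rewrite adj_sym.
Qed.

(** Cut a geodesic after [m] edges: the pieces bound both distances from above, and the triangle
    inequality forces equality. *)
Lemma gdist_split u v m n : gdist u v = m + n ->
  exists z, gdist u z = m /\ gdist z v = n.
Proof.
have [p [up pv sp]] := gdist_walk u v => E.
rewrite -(cat_take_drop m p) cat_path last_cat in up pv.
set z := last u (take m p) in up pv; case/andP: up => up zp.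
have := gdist_le_size up; have := gdist_le_size zp; rewrite pv -/z.
rewrite size_drop size_takel; last by lia.
have := gdist_triangle u z v; exists z; lia.
Qed.

End GraphDistance.

Section IntervalCliques.
Variable G : connGraph.
Implicit Types u v w x y z : G.

(** [INC0] with interval membership spelled out as distances, so that its premises are linear
    arithmetic. *)
Lemma INC0_adj u v x y n : INC0 G -> gdist u v = n.+1 ->
  gdist u x = 1 -> gdist u y = 1 -> gdist x v = n -> gdist y v = n ->
  x <> y -> adj x y.
Proof.
move=> inc uv ux uy xv yv; apply: (inc u v).
- by move=> E; rewrite E gdist_xx in uv.
- by split; [exact: gdist1_adj | rewrite /ginterval /= ux xv uv].
- by split; [exact: gdist1_adj | rewrite /ginterval /= uy yv uv].
Qed.

Lemma ball_2convex_INC0 :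
  (forall v r, kconvex 2 (@gball G r v)) -> INC0 G.
Proof.
move=> conv u v uv x y [/= ux]; rewrite /ginterval /= => xI [/= uy yI] xy.
have ux1 := adj_gdist ux; have uy1 := adj_gdist uy.
apply: gdist1_adj; apply: contrapT => nxy.
have := gdist_triangle x u y; rewrite (gdist_sym x u) => txy.
have dxy : gdist x y = 2.
  by case E: (gdist x y) nxy txy => [|[|[|n]]]; [case: xy; exact: gdist_eq0
     | lia | lia | lia].
(* The ball about [v] through [x] and [y] misses [u], yet [u] is a midpoint of [x] and [y]. *)
have := conv v (gdist u v).-1 x y _ _ _ u.
rewrite /gball /ginterval /= dxy (gdist_sym x u) ux1 uy1.
by rewrite (gdist_sym v x) (gdist_sym v y) (gdist_sym v u); lia.
Qed.

Lemma INC0_ball_2convex v r : INC0 G -> kconvex 2 (@gball G r v).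
Proof.
move=> inc x y; rewrite /gball /= => vx vy dxy z; rewrite /ginterval /= => zI.
have [zx|zx] := eqVneq (gdist x z) 0; first by rewrite -(gdist_eq0 zx).
have [zy|zy] := eqVneq (gdist z y) 0; first by rewrite (gdist_eq0 zy).
rewrite leqNgt; apply/negP => vz.
have := gdist_triangle v x z; have := gdist_triangle v y z.
have [zx' zv'] := (gdist_sym z x, gdist_sym z v).
have [xv' yv'] := (gdist_sym x v, gdist_sym y v).
rewrite (gdist_sym y z) => ty tx.
(* Here [z] is a common neighbor of [x] and [y] with d(z,v) = r+1, so both lie in I(z,v); their
   adjacency contradicts d(x,y) = 2. *)
have /adj_gdist : adj x y.
  apply: (@INC0_adj z v x y r) => //; try lia.
  by move=> E; move: zI; rewrite E gdist_xx; lia.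
lia.
Qed.

Lemma INC0_common_nbr n u v w w' : INC0 G -> gdist u v = n.+2 -> w <> w' ->
  gdist u w = 1 -> gdist u w' = 1 -> gdist w v = n.+1 -> gdist w' v = n.+1 ->
  exists z, [/\ gdist z v = n, adj z w & adj z w'].
Proof.
move=> inc; elim: n v => [|n IH] v uv ww' uw uw' wv w'v.
  exists v; rewrite gdist_xx !(adj_sym v); split=> //; exact: gdist1_adj.
have aww' : adj w w' := INC0_adj inc uv uw uw' wv w'v ww'.
have d1 := adj_gdist aww'.
(* The induction hypothesis for [p] gives a vertex at distance [n] from [p], hence [n.+1] from
   [v]. *)
have closer p : gdist w p = n.+1 -> gdist w' p = n.+1 -> gdist p v = 1 ->
    exists z, [/\ gdist z v = n.+1, adj z w & adj z w'].
  move=> wp w'p pv; have := gdist_triangle u p v.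
  have := gdist_triangle u w p => t1 t2.
  have [|z [zp zw zw']] := IH p _ ww' uw uw' wp w'p; first by lia.
  exists z; split=> //; have := gdist_triangle z p v.
  have := gdist_triangle w z v; rewrite (gdist_sym w z) (adj_gdist zw); lia.
have [p [wp pv]] : exists p, gdist w p = n.+1 /\ gdist p v = 1.
  by apply: gdist_split; lia.
have [q [w'q qv]] : exists q, gdist w' q = n.+1 /\ gdist q v = 1.
  by apply: gdist_split; lia.
have [w'p|w'p] := eqVneq (gdist w' p) n.+1; first exact: (closer p).
have [wq|wq] := eqVneq (gdist w q) n.+1; first exact: (closer q).
have wq2 : gdist w q = n.+2.
  have := gdist_triangle w w' q; have := gdist_triangle w q v; lia.
have apq : adj p q.
  have := gdist_triangle u w p; have := gdist_triangle u p v.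
  have := gdist_triangle u w' q; have := gdist_triangle u q v.
  have [vu vp vq] := And3 (gdist_sym v u) (gdist_sym v p) (gdist_sym v q).
  have [pu qu] := (gdist_sym p u, gdist_sym q u) => *.
  apply: (@INC0_adj v u p q n.+2) => //; try lia.
  by move=> E; move: wq; rewrite -E wp eqxx.
have [x [wx xp]] : exists x, gdist w x = 1 /\ gdist x p = n.
  by apply: gdist_split; lia.
have xv : gdist x v = n.+1.
  have := gdist_triangle w x v; have := gdist_triangle x p v; lia.
(* The vertex [x] itself is the common neighbor: passing through [p] gives d(x,q) = n+1, so [x] and
   [w'] are neighbors of [w] in I(w,q). *)
exists x; split=> //; first by rewrite adj_sym; exact: gdist1_adj.
apply: (@INC0_adj w q x w' n.+1) => //.
- have := gdist_triangle w x q; have := gdist_triangle x p q.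
  by rewrite (adj_gdist apq); lia.
- by move=> E; move: w'v; rewrite -E xv; lia.
Qed.

Lemma INC0_INC : INC0 G -> INC G.
Proof.
move=> inc; split=> // u v w w' uv ww' [uw wI] [uw' w'I].
rewrite /gsphere /ginterval /= in uw wI uw' w'I.
case E: (gdist u v) => [|[|n]]; first by case: uv; exact: gdist_eq0.
  (* For adjacent [u] and [v], both [w] and [w'] equal [v], against [w <> w']. *)
  have wv : gdist w v = 0 by lia.
  have w'v : gdist w' v = 0 by lia.
  by case: ww'; rewrite (gdist_eq0 wv) (gdist_eq0 w'v).
have wv : gdist w v = n.+1 by lia.
have w'v : gdist w' v = n.+1 by lia.
have [z [zv zw zw']] := INC0_common_nbr inc E ww' uw uw' wv w'v.
exists z; split=> //; split; rewrite /ginterval /=.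
- by rewrite (gdist_sym w z) (adj_gdist zw) zv wv.
- by rewrite (gdist_sym w' z) (adj_gdist zw') zv w'v.
Qed.

(** If d(a,c) = 2, then [b] and [d] are neighbors of [a] in I(a,c), so [INC0] joins them. *)
Lemma INC0_no_induced_C4 (a b c d : G) : INC0 G ->
  adj a b -> adj b c -> adj c d -> adj d a -> a <> c -> b <> d ->
  ~~ adj b d -> adj a c.
Proof.
move=> inc ab bc cd da nac nbd /negP nabd; apply: contrapT => nadj.
have ab1 := adj_gdist ab; have bc1 := adj_gdist bc.
have cd1 := adj_gdist cd; have da1 := adj_gdist da.
have ac2 : gdist a c = 2.
  have := gdist_triangle a b c.
  case E: (gdist a c) => [|[|n]]; [|by case: nadj; exact: gdist1_adj|lia].
  by case: nac; exact: gdist_eq0.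
apply: nabd; apply: (INC0_adj inc ac2) => //; by rewrite gdist_sym.
Qed.

Lemma INC0_seq_common_nbr n u v (s : seq G) : INC0 G -> gdist u v = n.+2 ->
  (forall w, List.In w s -> gdist u w = 1 /\ gdist w v = n.+1) ->
  exists z, [/\ gdist u z = 2, gdist z v = n &
    forall w, List.In w s -> adj z w].
Proof.
move=> inc uv; elim: s => [|w' s IH] sP.
  by have [z [uz zv]] := @gdist_split _ u v 2 n uv; exists z.
have [|z [uz zv zs]] := IH; first by move=> w ws; apply: sP; right.
have [uw' w'v] := sP w' (or_introl erefl).
have [zw'|nzw'] := boolP (adj z w').
  by exists z; split=> // w [<-|/zs].
(* This [w] links [z] to the new vertex [z']: both are neighbors of [w] in I(w,v), hence
   adjacent. *)
have [w [uw wz]] := @gdist_split _ u z 1 1 uz.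
have wv : gdist w v = n.+1.
  have := gdist_triangle w z v; have := gdist_triangle u w v; lia.
have ww' : w <> w'.
  by move=> E; move/negP: nzw'; apply; rewrite adj_sym -E; exact: gdist1_adj.
have [z' [z'v z'w z'w']] := INC0_common_nbr inc uv ww' uw uw' wv w'v.
have zz' : adj z z'.
  apply: (INC0_adj inc wv) => //; first by rewrite gdist_sym adj_gdist.
  by move=> E; rewrite E z'w' in nzw'.
exists z'; split=> //.
  have := gdist_triangle u w z'; have := gdist_triangle u z' v.
  by rewrite (gdist_sym w z') (adj_gdist z'w); lia.
move=> w1 [<- //|w1s].
have [uw1 w1v] := sP w1 (or_intror w1s).
have [E|w1w'] := pselect (w1 = w'); first by rewrite E.
(* In the 4-cycle z', z, w1, w' the diagonal from [z] to [w'] is missing, so the other one is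
   present. *)
apply: (@INC0_no_induced_C4 z' z w1 w') => //.
- by rewrite adj_sym.
- exact: zs.
- exact: (INC0_adj inc uv).
- by rewrite adj_sym.
- by move=> E; rewrite E w1v in z'v; lia.
- by move=> E; rewrite E w'v in zv; lia.
Qed.

(** Vertices carry no decidable equality: [List.In] avoids it in the statement, and [{classic G}]
    supplies it in the proof. *)
Lemma finite_set_List_In (A : set G) : finite_set A ->
  exists s : seq G, forall x, List.In x s <-> A x.
Proof.
move=> /(@finite_seqP {classic G}) [s ->]; exists s => x /=.
elim: s => //= a s IH; rewrite inE; split.
- by case=> [->|/IH ->]; rewrite ?eqxx ?orbT.
- by case/orP => [/eqP ->|/IH]; [left|right].
Qed.

(** The neighbors of [u] in I(u,v) form a clique, which is finite by assumption and can be
    listed. *)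
Lemma INC_INCplus : cliques_finite G -> INC G -> INCplus G.
Proof.
move=> fin [inc _]; split=> // u v [|[|n]] uv // _.
have uNv : u <> v by move=> E; rewrite E gdist_xx in uv.
have [s sP] := finite_set_List_In (fin _ (inc u v uNv)).
have [|z [uz zv zs]] := INC0_seq_common_nbr (s := s) inc uv.
  move=> w /sP [/= /adj_gdist uw]; rewrite /ginterval /= => wI; lia.
exists z; split; [by rewrite /ginterval /=; lia | by rewrite zv; lia |].
by move=> w [uw wI]; apply: zs; apply/sP; split=> //; exact: gdist1_adj.
Qed.

End IntervalCliques.

Theorem theorem3p1 (G : connGraph) (finG : cliques_finite G) :
  [<-> forall (v : G) (r : nat), kconvex 2 (gball r v);
       INC G;
       INCplus G].
Proof.
tfae.
- by move=> conv; apply: INC0_INC; exact: ball_2convex_INC0.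
- exact: INC_INCplus.
- by case=> inc _ v r; exact: INC0_ball_2convex.
Qed.
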